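(* For any $\varepsilon\in\mathbb C$ with $\varepsilon\neq0$, there is an isomorphism $\mathcal Q_n(\varepsilon)\cong\overline M_{n+2}$ between the fibre of $\mathcal Q_n\to\mathbb A^1$ over $\varepsilon$ and the Deligne–Mumford space, given by setting $\mu_{ij\,n+1}=\varepsilon^{-1}\nu_{ij}$ for distinct $i,j\in[n]$ (and keeping the coordinates $\mu_{ijk}$ for distinct $i,j,k\in[n]$).
   Context: For a finite set $S$, $p(S)$ (resp. $t(S)$) is the set of ordered pairs $ij$ (resp. triples $ijk$) of distinct elements. Equations between $\mathbb P^1$-valued coordinates are understood after homogenizing (clearing denominators). Schemes are over $\mathbb C$. $\mathcal Q_n$ (the deformation of the Mau–Woodward space) is the subscheme of $(\nu,\mu,\varepsilon)\in(\mathbb P^1)^{p([n])}\times(\mathbb P^1)^{t([n])}\times\mathbb A^1$ defined, for distinct $i,j,k,l\in[n]$, by $\mu_{ijk}\mu_{ikj}=1$, $\mu_{ijk}+\mu_{jik}=1$, $\mu_{ijk}\mu_{ikl}=\mu_{ijl}$, $\mu_{ijk}\nu_{ik}=\nu_{ij}$, $\nu_{ij}+\nu_{ji}=\varepsilon$, $\varepsilon\nu_{ik}+\nu_{ij}\nu_{jk}=\nu_{ik}\nu_{jk}+\nu_{ij}\nu_{ik}$. $\overline M_{n+2}$ is the Deligne–Mumford space of genus $0$ stable curves with marked points $z_0,z_1,\dots,z_{n+1}$. For distinct $i,j,k\in[n+1]$, let $\mu_{ijk}:\overline M_{n+2}\to\mathbb P^1$ be the cross-ratio equal to $\frac{z_i-z_k}{z_i-z_j}$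 when $z_0=\infty$. By a known theorem (Aguirre–Felder–Veselov), these embed $\overline M_{n+2}$ as the subscheme of $(\mathbb P^1)^{t([n+1])}$ defined by $\mu_{ijk}\mu_{ikj}=1$, $\mu_{ijk}+\mu_{jik}=1$, $\mu_{ijk}\mu_{ilj}=\mu_{ilk}$ for distinct indices in $[n+1]$. *)

(* Defs.v *)
From HB Require Import structures.
From mathcomp Require Import all_boot all_order all_algebra.
From mathcomp Require Import boolp reals complex ring.

Set Implicit Arguments.
Unset Strict Implicit.
Unset Printing Implicit Defensive.

Import GRing.Theory.
Local Open Scope ring_scope.

(* Schemes over a field K are represented by their functors of points, that   *)
(* is, by covariant functors from commutative K-algebras to sets, and         *)
(* K-morphisms of schemes by natural transformations; by Yoneda, a scheme is  *)
(* determined by the restriction of its functor of points to affine schemes,  *)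
(* and this embedding is fully faithful. (A comAlgType is a nonzero ring;     *)
(* nothing is lost, as the spectrum of the zero ring is empty, so that a      *)
(* scheme has exactly one point with values in the zero ring.)                *)

Record kfunctor (K : fieldType) := KFunctor {
  points :> comAlgType K -> Type;
  bc : forall A B : comAlgType K, {lrmorphism A -> B} -> points A -> points B;
  bc_id : forall (A : comAlgType K) (x : points A), bc idfun x = x;
  bc_comp : forall (A B C : comAlgType K) (g : {lrmorphism B -> C})
    (f : {lrmorphism A -> B}) (x : points A), bc (g \o f) x = bc g (bc f x)
}.
Arguments bc {K} X {A B} f x : rename.

Record morphism (K : fieldType) (X Y : kfunctor K) := Morphism {
  app :> forall A : comAlgType K, X A -> Y A;
  app_natural : forall (A B : comAlgType K) (f : {lrmorphism A -> B}) (x : X A),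
    app (bc X f x) = bc Y f (app x)
}.
Arguments app {K X Y} phi A x : rename.

Definition isomorphism (K : fieldType) (X Y : kfunctor K)
    (phi : morphism X Y) : Prop :=
  exists psi : morphism Y X, forall A : comAlgType K,
    cancel (phi A) (psi A) /\ cancel (psi A) (phi A).

Section AffineLine.
Variable K : fieldType.

Let A1_pts (A : comAlgType K) : Type := A.
Let A1_bc (A B : comAlgType K) (f : {lrmorphism A -> B}) (a : A1_pts A) :
  A1_pts B := f a.

Definition A1 : kfunctor K.
Proof. by exists A1_pts A1_bc. Defined.

End AffineLine.

Section Products.
Variable K : fieldType.

Definition prod_functor (X Y : kfunctor K) : kfunctor K.
Proof.
exists (fun A => (X A * Y A)%type)
       (fun A B f xy => (bc X f xy.1, bc Y f xy.2)).
- by move=> A [x y] /=; rewrite !bc_id.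
- by move=> A B C g f [x y] /=; rewrite !bc_comp.
Defined.

Definition power_functor (X : kfunctor K) (I : Type) : kfunctor K.
Proof.
exists (fun A => I -> X A) (fun A B f x i => bc X f (x i)).
- by move=> A x; apply: funext => i; rewrite bc_id.
- by move=> A B C g f x; apply: funext => i; rewrite bc_comp.
Defined.

Definition stable (X : kfunctor K) (P : forall A : comAlgType K, X A -> Prop) :=
  forall (A B : comAlgType K) (f : {lrmorphism A -> B}) (x : X A),
    P A x -> P B (bc X f x).

Definition subfunctor (X : kfunctor K) (P : forall A : comAlgType K, X A -> Prop)
  (stP : stable P) : kfunctor K.
Proof.
exists (fun A => {x : X A | P A x})
       (fun A B f x => exist _ (bc X f (sval x)) (stP _ _ f _ (svalP x))).
- by move=> A [x px]; apply: eq_exist => /=; rewrite bc_id.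
- by move=> A B C g f [x px]; apply: eq_exist => /=; rewrite bc_comp.
Defined.

Lemma fibre_stable (X : kfunctor K) (phi : morphism X (A1 K)) (c : K) :
  @stable X (fun A x => phi A x = c%:A).
Proof.
by move=> A B f x /= e; rewrite app_natural e /= linearZ rmorph1.
Qed.

Definition fibre (X : kfunctor K) (phi : morphism X (A1 K)) (c : K) :
  kfunctor K := subfunctor (@fibre_stable X phi c).

End Products.

(* A point of the projective line with values in A is a rank one direct       *)
(* summand L of A^2. The last two conditions below say that any two elements  *)
(* of L are proportional and that the coordinates of the elements of L        *)
(* generate the unit ideal (x.1 + y.2 suffices, L being a submodule). They    *)
(* hold if and only if L is, locally on Spec A, generated by one unimodular   *)
(* vector (a, b), i.e. L is locally [a : b]; for A local, L = A (a, b).       *)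
(* The affine coordinate of the point is a / b.                               *)
Record P1pt (K : fieldType) (A : comAlgType K) := P1Pt {
  P1mem :> A * A -> Prop;
  P1mem0 : P1mem (0, 0);
  P1memL : forall (a : A) (x y : A * A), P1mem x -> P1mem y ->
    P1mem (a * x.1 + y.1, a * x.2 + y.2);
  P1mem_prop : forall x y : A * A, P1mem x -> P1mem y -> x.1 * y.2 = x.2 * y.1;
  P1mem_unit : exists x y : A * A, [/\ P1mem x, P1mem y & x.1 + y.2 = 1]
}.

Lemma P1pt_eq (K : fieldType) (A : comAlgType K) (p q : P1pt A) :
  (forall x, p x <-> q x) -> p = q.
Proof.
case: p q => [p p0 pL pp pu] [q q0 qL qp qu] /= e.
have epq : p = q by apply: funext => x; apply: propext.
by subst q; congr P1Pt; apply: Prop_irrelevance.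
Qed.

(* Extension of scalars: the B-submodule of B^2 spanned by the image of L. *)
Inductive spanned (K : fieldType) (A B : comAlgType K) (f : A -> B)
    (L : A * A -> Prop) : B * B -> Prop :=
| Spanned0 : spanned f L (0, 0)
| SpannedL (b : B) (x : A * A) (y : B * B) : L x -> spanned f L y ->
    spanned f L (b * f x.1 + y.1, b * f x.2 + y.2).

Section BaseChange.
Variables (K : fieldType) (A B : comAlgType K) (f : {lrmorphism A -> B}).

Definition lin (G : B * B -> B) :=
  G (0, 0) = 0 /\
  forall b x y, G (b * x.1 + y.1, b * x.2 + y.2) = b * G x + G y.

Definition im (x : A * A) : B * B := (f x.1, f x.2).

Lemma spanned_lin (L : A * A -> Prop) (G : B * B -> B) : lin G ->
  (forall x, L x -> G (im x) = 0) -> forall y, spanned f L y -> G y = 0.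
Proof.
move=> [G0 GL] GI y; elim=> [//|b x z Lx _ Gz].
by have := GL b (im x) z; rewrite /= => ->; rewrite GI // Gz mulr0 addr0.
Qed.

Lemma spanned_im (L : A * A -> Prop) x : L x -> spanned f L (im x).
Proof.
by move=> Lx; have := SpannedL 1 Lx (Spanned0 f L); rewrite /= !mul1r !addr0.
Qed.

Lemma spanned_closed (L : A * A -> Prop) (b : B) x y :
  spanned f L x -> spanned f L y ->
  spanned f L (b * x.1 + y.1, b * x.2 + y.2).
Proof.
move=> Lx Ly; elim: Lx => [|c z w Lz _ IH] /=.
  by rewrite !mulr0 !add0r; case: y Ly.
by rewrite !mulrDr !mulrA -!addrA; apply: (SpannedL (b * c) Lz IH).
Qed.

Definition P1pt_bc (p : P1pt A) : P1pt B.
Proof.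
exists (spanned f p).
- exact: Spanned0.
- by move=> b x y; apply: spanned_closed.
- move=> x y px py; apply/eqP; rewrite -subr_eq0; apply/eqP.
  move: x px; apply: (spanned_lin (G := fun x => x.1 * y.2 - x.2 * y.1)).
    by split=> [|b x z] /=; ring.
  move=> x px; move: y py.
  apply: (spanned_lin (G := fun y => (im x).1 * y.2 - (im x).2 * y.1)).
    by split=> [|b y z] /=; ring.
  by move=> y py /=; rewrite -!rmorphM -rmorphB (P1mem_prop px py) subrr rmorph0.
- have [x [y [px py e]]] := P1mem_unit p.
  exists (im x), (im y); split; try exact: spanned_im.
  by rewrite /= -rmorphD e rmorph1.
Defined.

End BaseChange.

Definition P1 (K : fieldType) : kfunctor K.
Proof.
exists (fun A => P1pt A) (fun A B f => P1pt_bc f).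
- move=> A p; apply: P1pt_eq => x; split=> [|px].
    by elim=> [|b y z py _ pz]; [apply: P1mem0 | apply: P1memL].
  by have := spanned_im idfun px; case: x {px}.
- move=> A B C g f p; apply: P1pt_eq => x; split.
    elim=> [|c y z py _ IH]; first exact: Spanned0.
    exact: (SpannedL c (spanned_im f py) IH).
  elim=> [|c y z py _ IH]; first exact: Spanned0.
  suff h : spanned (g \o f) p (im g y).
    exact: (@spanned_closed _ _ _ (g \o f) _ c _ _ h IH).
  elim: py => [|b u v pu _ IHv] /=.
    by rewrite /im /= rmorph0; apply: Spanned0.
  by rewrite /im /= !rmorphD !rmorphM; apply: (SpannedL (g b) pu IHv).
Defined.

(* The automorphism p |-> c p of the projective line, [a : b] |-> [c a : b]. *)
Definition P1scale (K : fieldType) (c : K) (c0 : c != 0) (A : comAlgType K)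
  (p : P1 K A) : P1 K A.
Proof.
exists (fun y : A * A => exists2 x, P1mem p x & y = (c *: x.1, x.2)).
- by exists (0, 0); [apply: P1mem0 | rewrite scaler0].
- move=> a _ _ [x px ->] [y py ->] /=.
  exists (a * x.1 + y.1, a * x.2 + y.2); first exact: P1memL.
  by rewrite /= scalerDr scalerAr.
- move=> _ _ [x px ->] [y py ->] /=.
  by rewrite -scalerAl (P1mem_prop px py) scalerAr.
- have [x [y [px py e]]] := P1mem_unit p.
  have px' : P1mem p (c^-1 *: x.1, c^-1 *: x.2).
    have := P1memL (c^-1%:A) px (P1mem0 p).
    by rewrite /= !addr0 -!scalerAl !mul1r.
  exists (c *: (c^-1 *: x.1), c^-1 *: x.2), (c *: y.1, y.2).
  split; [by exists (c^-1 *: x.1, c^-1 *: x.2) | by exists y |].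
  by rewrite /= scalerA divff // scale1r.
Defined.

(* Equations between coordinates on the projective line. Each is multilinear  *)
(* after clearing denominators, and is required of all the representatives    *)
(* (x.1, x.2) of the coordinate x.1 / x.2; by linearity this is the vanishing *)
(* on local generators of the submodules.                                     *)
Section Equations.
Variables (K : fieldType) (A : comAlgType K).
Implicit Types (p q r : P1 K A) (c : A).

(* p + q = c *)
Definition eq_add p q c := forall x y, P1mem p x -> P1mem q y ->
  x.1 * y.2 + y.1 * x.2 = c * x.2 * y.2.

(* p q = 1 *)
Definition eq_mul1 p q := forall x y, P1mem p x -> P1mem q y ->
  x.1 * y.1 = x.2 * y.2.

(* p q = r *)
Definition eq_mul p q r := forall x y z, P1mem p x -> P1mem q y -> P1mem r z ->
  x.1 * y.1 * z.2 = z.1 * x.2 * y.2.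

(* c r + p q = r q + p r *)
Definition eq_quad p q r c :=
  forall x y z, P1mem p x -> P1mem q y -> P1mem r z ->
  c * z.1 * x.2 * y.2 + x.1 * y.1 * z.2 = z.1 * y.1 * x.2 + x.1 * z.1 * y.2.

End Equations.

Section EquationsStable.
Variables (K : fieldType) (A B : comAlgType K) (f : {lrmorphism A -> B}).
Implicit Types (p q r : P1 K A) (c : A).
Let b p := bc (P1 K) f p.

Lemma bilin0 (G : B * B -> B * B -> B) p q :
  (forall y, lin (G^~ y)) -> (forall x, lin (G x)) ->
  (forall x y, P1mem p x -> P1mem q y -> G (im f x) (im f y) = 0) ->
  forall x y, P1mem (b p) x -> P1mem (b q) y -> G x y = 0.
Proof.
move=> G1 G2 GI x y px py; move: x px; apply: (spanned_lin (G1 y)) => x px.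
by move: y py; apply: (spanned_lin (G2 (im f x))) => y py; apply: GI.
Qed.

Lemma trilin0 (G : B * B -> B * B -> B * B -> B) p q r :
  (forall y z, lin (fun x => G x y z)) -> (forall x z, lin (fun y => G x y z)) ->
  (forall x y, lin (G x y)) ->
  (forall x y z, P1mem p x -> P1mem q y -> P1mem r z ->
     G (im f x) (im f y) (im f z) = 0) ->
  forall x y z, P1mem (b p) x -> P1mem (b q) y -> P1mem (b r) z -> G x y z = 0.
Proof.
move=> G1 G2 G3 GI x y z px py pz; move: x px.
apply: (spanned_lin (G1 y z)) => x px.
move: y z py pz; apply: bilin0 => [z|y|y z py pz] //; exact: GI.
Qed.

Lemma eq_add_bc p q c : eq_add p q c -> eq_add (b p) (b q) (f c).
Proof.
move=> e x y px py; apply/eqP; rewrite -subr_eq0; apply/eqP.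
apply: (bilin0 (G := fun x y : B * B =>
  x.1 * y.2 + y.1 * x.2 - f c * x.2 * y.2) _ _ _ px py).
- by move=> y'; split=> [|k u v] /=; ring.
- by move=> x'; split=> [|k u v] /=; ring.
- move=> u v pu pv /=; have := congr1 f (e _ _ pu pv).
  by rewrite !rmorphD !rmorphM => ->; rewrite subrr.
Qed.

Lemma eq_mul1_bc p q : eq_mul1 p q -> eq_mul1 (b p) (b q).
Proof.
move=> e x y px py; apply/eqP; rewrite -subr_eq0; apply/eqP.
apply: (bilin0 (G := fun x y : B * B => x.1 * y.1 - x.2 * y.2) _ _ _ px py).
- by move=> y'; split=> [|k u v] /=; ring.
- by move=> x'; split=> [|k u v] /=; ring.
- move=> u v pu pv /=; have := congr1 f (e _ _ pu pv).
  by rewrite !rmorphM => ->; rewrite subrr.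
Qed.

Lemma eq_mul_bc p q r : eq_mul p q r -> eq_mul (b p) (b q) (b r).
Proof.
move=> e x y z px py pz; apply/eqP; rewrite -subr_eq0; apply/eqP.
apply: (trilin0 (G := fun x y z : B * B =>
  x.1 * y.1 * z.2 - z.1 * x.2 * y.2) _ _ _ _ px py pz).
- by move=> y' z'; split=> [|k u v] /=; ring.
- by move=> x' z'; split=> [|k u v] /=; ring.
- by move=> x' y'; split=> [|k u v] /=; ring.
- move=> u v w pu pv pw /=; have := congr1 f (e _ _ _ pu pv pw).
  by rewrite !rmorphM => ->; rewrite subrr.
Qed.

Lemma eq_quad_bc p q r c :
  eq_quad p q r c -> eq_quad (b p) (b q) (b r) (f c).
Proof.
move=> e x y z px py pz; apply/eqP; rewrite -subr_eq0; apply/eqP.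
apply: (trilin0 (G := fun x y z : B * B =>
  f c * z.1 * x.2 * y.2 + x.1 * y.1 * z.2 - (z.1 * y.1 * x.2 + x.1 * z.1 * y.2))
  _ _ _ _ px py pz).
- by move=> y' z'; split=> [|k u v] /=; ring.
- by move=> x' z'; split=> [|k u v] /=; ring.
- by move=> x' y'; split=> [|k u v] /=; ring.
- move=> u v w pu pv pw /=; have := congr1 f (e _ _ _ pu pv pw).
  by rewrite !rmorphD !rmorphM => ->; rewrite subrr.
Qed.

End EquationsStable.

(* The index sets p(S) and t(S). In the equations below the distinctness      *)
(* proofs attached to each coordinate are quantified separately; they are     *)
(* boolean, hence irrelevant, and together say that all indices are distinct. *)
Definition pairs (S : finType) := {ij : S * S | ij.1 != ij.2}.
Definition triples (S : finType) :=
  {ijk : S * S * S | uniq [:: ijk.1.1; ijk.1.2; ijk.2]}.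

Definition pair_of (S : finType) (i j : S) (h : i != j) : pairs S :=
  exist _ (i, j) h.
Definition triple_of (S : finType) (i j k : S) (h : uniq [:: i; j; k]) :
  triples S := exist _ (i, j, k) h.

Section MauWoodwardDeformation.
Variables (K : fieldType) (n : nat).

Definition Qambient : kfunctor K :=
  prod_functor (prod_functor (power_functor (P1 K) (pairs 'I_n))
                             (power_functor (P1 K) (triples 'I_n)))
               (A1 K).

Section Coordinates.
Variables (A : comAlgType K) (x : Qambient A).
Definition nu (i j : 'I_n) (h : i != j) : P1 K A := x.1.1 (pair_of h).
Definition mu (i j k : 'I_n) (h : uniq [:: i; j; k]) : P1 K A :=
  x.1.2 (triple_of h).
Definition eps : A := x.2.
End Coordinates.

Record Qeqs (A : comAlgType K) (x : Qambient A) : Prop := {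
  Q_mul1 : forall (i j k : 'I_n) (ijk : uniq [:: i; j; k])
    (ikj : uniq [:: i; k; j]), eq_mul1 (mu x ijk) (mu x ikj);
  Q_add1 : forall (i j k : 'I_n) (ijk : uniq [:: i; j; k])
    (jik : uniq [:: j; i; k]), eq_add (mu x ijk) (mu x jik) 1;
  Q_mul : forall (i j k l : 'I_n) (ijk : uniq [:: i; j; k])
    (ikl : uniq [:: i; k; l]) (ijl : uniq [:: i; j; l]),
    eq_mul (mu x ijk) (mu x ikl) (mu x ijl);
  Q_munu : forall (i j k : 'I_n) (ijk : uniq [:: i; j; k])
    (ik : i != k) (ij : i != j), eq_mul (mu x ijk) (nu x ik) (nu x ij);
  Q_add : forall (i j : 'I_n) (ij : i != j) (ji : j != i),
    eq_add (nu x ij) (nu x ji) (eps x);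
  Q_quad : forall (i j k : 'I_n) (ij : i != j) (jk : j != k) (ik : i != k),
    eq_quad (nu x ij) (nu x jk) (nu x ik) (eps x)
}.

Lemma Q_stable : stable Qeqs.
Proof.
move=> A B f x [h1 h2 h3 h4 h5 h6]; split=> *.
- exact/eq_mul1_bc/h1.
- by rewrite -[1](rmorph1 f); apply/eq_add_bc/h2.
- exact/eq_mul_bc/h3.
- exact/eq_mul_bc/h4.
- exact/eq_add_bc/h5.
- exact/eq_quad_bc/h6.
Qed.

Definition Q : kfunctor K := subfunctor Q_stable.

Definition Qproj : morphism Q (A1 K).
Proof. by exists (fun A (x : Q A) => eps (sval x)). Defined.

Definition Qfibre (e : K) : kfunctor K := fibre Qproj e.

Definition Qfibre_nu (e : K) (A : comAlgType K) (x : Qfibre e A)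
  (i j : 'I_n) (h : i != j) : P1 K A := nu (sval (sval x)) h.
Definition Qfibre_mu (e : K) (A : comAlgType K) (x : Qfibre e A)
  (i j k : 'I_n) (h : uniq [:: i; j; k]) : P1 K A := mu (sval (sval x)) h.

End MauWoodwardDeformation.

Section DeligneMumford.
Variables (K : fieldType) (n : nat).

(* The index set {1, ..., n+1} is 'I_n.+1, with ord_max standing for n+1. *)
Definition Mambient : kfunctor K := power_functor (P1 K) (triples 'I_n.+1).

Definition Mcoord (A : comAlgType K) (x : Mambient A) (i j k : 'I_n.+1)
  (h : uniq [:: i; j; k]) : P1 K A := x (triple_of h).

Record Meqs (A : comAlgType K) (x : Mambient A) : Prop := {
  M_mul1 : forall (i j k : 'I_n.+1) (ijk : uniq [:: i; j; k])
    (ikj : uniq [:: i; k; j]), eq_mul1 (Mcoord x ijk) (Mcoord x ikj);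
  M_add1 : forall (i j k : 'I_n.+1) (ijk : uniq [:: i; j; k])
    (jik : uniq [:: j; i; k]), eq_add (Mcoord x ijk) (Mcoord x jik) 1;
  M_mul : forall (i j k l : 'I_n.+1) (ijk : uniq [:: i; j; k])
    (ilj : uniq [:: i; l; j]) (ilk : uniq [:: i; l; k]),
    eq_mul (Mcoord x ijk) (Mcoord x ilj) (Mcoord x ilk)
}.

Lemma M_stable : stable Meqs.
Proof.
move=> A B f x [h1 h2 h3]; split=> *.
- exact/eq_mul1_bc/h1.
- by rewrite -[1](rmorph1 f); apply/eq_add_bc/h2.
- exact/eq_mul_bc/h3.
Qed.

(* The moduli space of stable curves of genus 0 with the n + 2 marked points  *)
(* z_0, ..., z_{n+1}, in its embedding by the cross-ratios mu_{ijk}           *)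
(* (Aguirre, Felder and Veselov).                                             *)
Definition Mbar : kfunctor K := subfunctor M_stable.

Definition Mbar_mu (A : comAlgType K) (x : Mbar A) (i j k : 'I_n.+1)
  (h : uniq [:: i; j; k]) : P1 K A := Mcoord (sval x) h.

End DeligneMumford.

Definition incl (n : nat) : 'I_n -> 'I_n.+1 := widen_ord (leqnSn n).

(* The coordinates mu_{i n+1 j} and mu_{n+1 i j} of phi are then determined   *)
(* by the relations M_mul1 and M_add1.                                        *)
Definition given_by (K : fieldType) (n : nat) (e : K) (e0 : e != 0)
    (phi : morphism (Qfibre n e) (Mbar K n)) : Prop :=
  forall (A : comAlgType K) (x : Qfibre n e A),
    (forall (i j : 'I_n) (ij : i != j)
       (ijn : uniq [:: incl i; incl j; ord_max]),
       Mbar_mu (phi A x) ijn = P1scale (invr_neq0 e0) (Qfibre_nu x ij)) /\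
    (forall (i j k : 'I_n) (ijk : uniq [:: i; j; k])
       (ijk' : uniq [:: incl i; incl j; incl k]),
       Mbar_mu (phi A x) ijk' = Qfibre_mu x ijk).

(* Main.v *)
Require Import Defs.
From mathcomp Require Import all_boot all_order all_algebra.
From mathcomp Require Import boolp reals complex ring.

Set Implicit Arguments.
Unset Strict Implicit.
Unset Printing Implicit Defensive.

Import GRing.Theory.
Local Open Scope ring_scope.

(** The fibre and the moduli space have almost the same coordinates: a point
of the moduli space gives one of the fibre by [nu_ij = e mu_ijm], where [m] is
the last of the [n + 1] indices, and by keeping [mu_ijk] for [i], [j], [k]
different from [m]. The proof shows that this restriction map is a bijection on
points with values in any algebra; since it is natural, its inverse is natural
too and is the isomorphism.

The relations of the fibre hold for a restricted point. Except for the
quadratic relation and the value of [eps], they are the relations of the moduli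
space for indices one of which may be [m], with the [nu] rescaled by [e]. The
quadratic one, in terms of [a = mu_ijm], [b = mu_jkm], [c = mu_ikm], reads
[c + a b = c b + a c]. It expresses [u + (1 - u) = 1] for [u = mu_ijk], because
[u = a / c] and [1 - u = mu_jik = (1 - a) / b]. The algebra may have zero
divisors and the coordinates may be infinite, so one cannot divide: instead, the
difference of the two sides is shown to be killed by both homogeneous
coordinates of [u], which generate the unit ideal ([eq_quad_of_cross]).

The restriction is injective ([restrict_inj]): the coordinates that it forgets
are [mu_imj = 1 / mu_ijm] and [mu_mij = 1 - 1 / mu_ijm].

It is surjective ([restrict_surj]): define the missing coordinates by these
formulas. The relations [mu_ijk mu_ikj = 1] and [mu_ijk + mu_jik = 1] then hold
because [p |-> 1 / p] and [p |-> 1 - p] generate an action of the symmetric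
group on three letters ([P1compl_inv_compl]). The multiplicative relation with
first index [m] is
[(1 - 1 / b) (1 - 1 / a) = 1 - 1 / c], with [a], [b], [c] the rescaled
coordinates [nu_ij / e], [nu_jk / e], [nu_ik / e]; clearing denominators turns
it into the quadratic relation ([ext_mul_at_max]). With [m] at any other place
the multiplicative relation is [mu_ijk nu_ik = nu_ij] up to moving factors
across.

Finally, a morphism given by the prescribed formulas is unique, again because
these coordinates determine a point of the moduli space ([Mbar_ext]). *)

(** Leaves a polynomial identity to [ring], with [k] as certificate that the
new equation follows from a known one. *)
Lemma eq_from_multiple (A : comNzRingType) (k a b c d : A) :
  a = b -> c - d = k * (a - b) -> c = d.
Proof. by move=> ->; rewrite subrr mulr0 => /subr0_eq. Qed.

(** * Points of the projective line *)

(** Two rank one direct summands of [A * A] whose elements are proportional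
coincide. For [u], [v] in [r] with [u.1 + v.2 = 1], an element [y] proportional
to both is [y.1 u + y.2 v], hence lies in [r]. *)
Lemma P1pt_eq_proportional (K : fieldType) (A : comAlgType K) (p q : P1 K A) :
  (forall x y, P1mem p x -> P1mem q y -> x.1 * y.2 = x.2 * y.1) -> p = q.
Proof.
have sub (r s : P1 K A) :
    (forall x y, P1mem r x -> P1mem s y -> x.1 * y.2 = x.2 * y.1) ->
    forall y, P1mem s y -> P1mem r y.
  move=> rs y sy; have [u [v [ru rv e]]] := P1mem_unit r.
  have rvy : P1mem r (y.2 * v.1 + 0, y.2 * v.2 + 0).
    exact: (P1memL y.2 rv (P1mem0 r)).
  have := P1memL y.1 ru rvy; rewrite /= !addr0.
  have eu := rs _ _ ru sy; have ev := rs _ _ rv sy.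
  have -> : y.1 * u.1 + y.2 * v.1 = y.1.
    by rewrite -[RHS]mulr1 -e; ring: ev.
  have -> : y.1 * u.2 + y.2 * v.2 = y.2.
    by rewrite -[RHS]mulr1 -e; ring: eu.
  by case: y {sy rvy eu ev}.
move=> pq; apply: P1pt_eq => x; split; last exact: sub.
by apply: sub => y z qy pz; rewrite mulrC -(pq _ _ pz qy) mulrC.
Qed.

(** The point [1 / p]. *)
Definition P1inv (K : fieldType) (A : comAlgType K) (p : P1 K A) : P1 K A.
Proof.
exists (fun x => P1mem p (x.2, x.1)).
- exact: P1mem0.
- by move=> a x y; apply: P1memL.
- by move=> x y px py; have /= := P1mem_prop px py.
- have [x [y [px py e]]] := P1mem_unit p.
  exists (y.2, y.1), (x.2, x.1); split=> /=; last by rewrite addrC.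
    by case: y py {e}.
  by case: x px {e}.
Defined.

(** The point [1 - p]. *)
Definition P1compl (K : fieldType) (A : comAlgType K) (p : P1 K A) : P1 K A.
Proof.
exists (fun x => P1mem p (x.2 - x.1, x.2)).
- by rewrite /= subrr; apply: P1mem0.
- move=> a x y px py; have /= := P1memL a px py.
  by congr (P1mem p (_, _)); ring.
- move=> x y px py; have /= h := P1mem_prop px py.
  by apply: (eq_from_multiple (k := -1) h); ring.
- have [x [y [px py e]]] := P1mem_unit p.
  (* The preimages of [- x] and [x + y] under [(a, b) |-> (b - a, b)]. *)
  exists (x.1 - x.2, - x.2), (y.2 + x.2 - (y.1 + x.1), y.2 + x.2).
  split; last by rewrite /= -e; ring.
  - have := P1memL (-1) px (P1mem0 p).
    by rewrite /= !mulN1r !addr0; congr (P1mem p (_, _)); ring.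
  - have := P1memL 1 px py.
    by rewrite /= !mul1r; congr (P1mem p (_, _)); ring.
Defined.

Lemma P1memN (K : fieldType) (A : comAlgType K) (p : P1 K A) (a b : A) :
  P1mem p (a, b) -> P1mem p (- a, - b).
Proof. by move/(P1memL (-1))/(_ (P1mem0 p)); rewrite /= !mulN1r !addr0. Qed.

Lemma P1invK (K : fieldType) (A : comAlgType K) : involutive (@P1inv K A).
Proof. by move=> p; apply: P1pt_eq => -[a b]. Qed.

Lemma P1complK (K : fieldType) (A : comAlgType K) : involutive (@P1compl K A).
Proof. by move=> p; apply: P1pt_eq => -[a b] /=; rewrite opprB addrC subrK. Qed.

(** The braid relation between the involutions [p |-> 1 - p] and [p |-> 1 / p];
both sides are the point [p / (p - 1)], on representatives that differ by a
sign. *)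
Lemma P1compl_inv_compl (K : fieldType) (A : comAlgType K) (p : P1 K A) :
  P1compl (P1inv (P1compl p)) = P1inv (P1compl (P1inv p)).
Proof.
apply: P1pt_eq => x /=.
by split=> /P1memN; congr (P1mem p (_, _)); ring.
Qed.

Lemma P1scaleK (K : fieldType) (A : comAlgType K) (c d : K) (c0 : c != 0)
    (d0 : d != 0) (p : P1 K A) :
  d * c = 1 -> P1scale d0 (P1scale c0 p) = p.
Proof.
move=> dc; apply: P1pt_eq_proportional => _ y [_ [x px ->] ->] py /=.
by rewrite scalerA dc scale1r; apply: P1mem_prop px py.
Qed.

Lemma P1scale_bc (K : fieldType) (c : K) (c0 : c != 0) (A B : comAlgType K)
    (f : {lrmorphism A -> B}) (p : P1 K A) :
  bc (P1 K) f (P1scale c0 p) = P1scale c0 (bc (P1 K) f p).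
Proof.
apply: P1pt_eq_proportional => x _ px [y py ->] /=.
apply/eqP; rewrite -subr_eq0; apply/eqP.
apply: (bilin0 (G := fun x y : B * B => x.1 * y.2 - x.2 * (c *: y.1))
  _ _ _ px py).
- by move=> z; split=> [|k u v] /=; ring.
- move=> z; split=> [|k u v] /=; first by rewrite scaler0; ring.
  by rewrite scalerDr scalerAr; ring.
- move=> _ v [u pu ->] pv /=.
  rewrite linearZ /= -scalerAl -scalerAr -scalerBr -!rmorphM -rmorphB.
  by rewrite (P1mem_prop pu pv) subrr rmorph0 scaler0.
Qed.

(** * Equations between points *)

Lemma eq_mul1P (K : fieldType) (A : comAlgType K) (p q : P1 K A) :
  eq_mul1 p q <-> q = P1inv p.
Proof.
split=> [pq|->] => [|x y px /(P1mem_prop px)//].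
apply: P1pt_eq_proportional => y x qy /(pq _ _)/(_ qy) /= h.
by rewrite mulrC h mulrC.
Qed.

Lemma eq_addP (K : fieldType) (A : comAlgType K) (p q : P1 K A) :
  eq_add p q 1 <-> q = P1compl p.
Proof.
split=> [pq|-> x y px /(P1mem_prop px) /= h]; last first.
  by apply: (eq_from_multiple (k := 1) h); ring.
apply: P1pt_eq_proportional => y x qy /(pq _ _)/(_ qy) /= h.
by apply: (eq_from_multiple (k := 1) h); ring.
Qed.

Lemma eq_mulC (K : fieldType) (A : comAlgType K) (p q r : P1 K A) :
  eq_mul p q r -> eq_mul q p r.
Proof.
by move=> pqr y x z qy px rz; rewrite [y.1 * _]mulrC (pqr x y z) // mulrAC.
Qed.

(** As 0 and infinity are allowed values, [r / q = p] follows from [p q = r]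
only as a homogenized equation: the two have the same homogenization. The same
is true of [(1 / r) p = 1 / q] below. *)
Lemma eq_mul_divl (K : fieldType) (A : comAlgType K) (p q r : P1 K A) :
  eq_mul p q r -> eq_mul r (P1inv q) p.
Proof.
move=> pqr z y x rz qy px; have /= h := pqr _ _ _ px qy rz.
by apply: (eq_from_multiple (k := -1) h); ring.
Qed.

Lemma eq_mul_inv (K : fieldType) (A : comAlgType K) (p q r : P1 K A) :
  eq_mul p q r -> eq_mul (P1inv r) p (P1inv q).
Proof.
move=> pqr z x y rz px qy; have /= h := pqr _ _ _ px qy rz.
by apply: (eq_from_multiple (k := 1) h); ring.
Qed.

Lemma eq_add_scale (K : fieldType) (A : comAlgType K) (c : K) (c0 : c != 0)
    (p q : P1 K A) (a : A) :
  eq_add p q a -> eq_add (P1scale c0 p) (P1scale c0 q) (c *: a).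
Proof.
move=> pq _ _ [x px ->] [y py ->] /=.
by rewrite -!scalerAl -scalerDr (pq _ _ px py).
Qed.

Lemma eq_mul_scale (K : fieldType) (A : comAlgType K) (c : K) (c0 : c != 0)
    (u p q : P1 K A) :
  eq_mul u p q -> eq_mul u (P1scale c0 p) (P1scale c0 q).
Proof.
move=> upq x _ _ ux [y py ->] [z qz ->] /=.
by rewrite -scalerAr -!scalerAl (upq _ _ _ ux py qz).
Qed.

Lemma eq_quad_scale (K : fieldType) (A : comAlgType K) (c : K) (c0 : c != 0)
    (p q r : P1 K A) (a : A) :
  eq_quad p q r a ->
  eq_quad (P1scale c0 p) (P1scale c0 q) (P1scale c0 r) (c *: a).
Proof.
move=> pqr _ _ _ [x px ->] [y qy ->] [z rz ->] /=.
rewrite -!scalerAl -!scalerAr -!scalerAl -!scalerDr.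
by rewrite (pqr _ _ _ px qy rz).
Qed.

(** The hypotheses say [u c = a], [(1 - u) b = 1 - a] and
[(1 - 1 / u) (1 - b) = 1 - c]. The second coordinate of [u] kills the
difference of the two sides of the quadratic equation by the first two
hypotheses. Replacing [u], [a], [b], [c] by [1 / u], [c], [1 - b], [a]
preserves the quadratic equation and exchanges the second and third hypotheses,
so the first coordinate of [u] kills it as well. *)
Lemma eq_quad_of_cross (K : fieldType) (A : comAlgType K) (u a b c : P1 K A) :
  eq_mul u c a -> eq_mul (P1compl u) b (P1compl a) ->
  eq_mul (P1compl (P1inv u)) (P1compl b) (P1compl c) ->
  eq_quad a b c 1.
Proof.
move=> uca ua ic x y z ax qy cz; have [s [t [us ut st]]] := P1mem_unit u.
pose D := 1 * z.1 * x.2 * y.2 + x.1 * y.1 * z.2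
  - (z.1 * y.1 * x.2 + x.1 * z.1 * y.2).
have cm (p : P1 K A) v : P1mem p v -> P1mem (P1compl p) (v.2 - v.1, v.2).
  by case: v => v1 v2 pv /=; rewrite opprB addrC subrK.
have im (p : P1 K A) v : P1mem p v -> P1mem (P1inv p) (v.2, v.1).
  by case: v.
have sD : s.1 * D = 0.
  have e1 := uca _ _ _ us cz ax.
  have /= e2 := ic _ _ _ (cm _ _ (im _ _ us)) (cm _ _ qy) (cm _ _ cz).
  transitivity ((y.2 - y.1) * (s.1 * z.1 * x.2 - x.1 * s.2 * z.2)
    - x.1 * ((s.1 - s.2) * (y.2 - y.1) * z.2 - (z.2 - z.1) * s.1 * y.2)).
    by rewrite /D; ring.
  by rewrite e1 e2 !subrr !mulr0 subrr.
have tD : t.2 * D = 0.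
  have e1 := uca _ _ _ ut cz ax.
  have /= e2 := ua _ _ _ (cm _ _ ut) qy (cm _ _ ax).
  transitivity (- y.1 * (t.1 * z.1 * x.2 - x.1 * t.2 * z.2)
    - z.1 * ((t.2 - t.1) * y.1 * x.2 - (x.2 - x.1) * t.2 * y.2)).
    by rewrite /D; ring.
  by rewrite e1 e2 !subrr !mulr0 subrr.
by apply: subr0_eq; rewrite -/D -[D]mul1r -st mulrDl sD tD addr0.
Qed.

(** * Triples of indices and the last index *)

Lemma inclE n (i : 'I_n) : incl i = lift ord_max i.
Proof. by apply: val_inj; rewrite /= /bump leqNgt ltn_ord. Qed.

Lemma incl_uniq3 n (i j k : 'I_n) :
  uniq [:: incl i; incl j; incl k] = uniq [:: i; j; k].
Proof.
apply: (@map_inj_uniq _ _ (@incl n) _ [:: i; j; k]) => u v.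
by rewrite !inclE => /lift_inj.
Qed.

Lemma incl_uniq2 n (i j : 'I_n) :
  uniq [:: incl i; incl j; ord_max] = (i != j).
Proof.
by rewrite /= !inE !inclE (inj_eq lift_inj) !lift_eqF orbF !andbT.
Qed.

Lemma incl_uniq_mid n (i j : 'I_n) :
  uniq [:: incl i; ord_max; incl j] = (i != j).
Proof.
by rewrite -incl_uniq2; apply/perm_uniq/permP => P /=; ring.
Qed.

Lemma incl_uniq_first n (i j : 'I_n) :
  uniq [:: ord_max; incl i; incl j] = (i != j).
Proof.
by rewrite -incl_uniq2; apply/perm_uniq/permP => P /=; ring.
Qed.

Definition incl_uniq :=
  (incl_uniq3, incl_uniq2, incl_uniq_mid, incl_uniq_first).

(** Transfers distinctness between permuted explicit lists of indices: the
equality of counts unfolds to an identity of sums. *)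
Lemma uniq_count (T : eqType) (s t : seq T) :
  uniq s -> (forall P : pred T, count P s = count P t) -> uniq t.
Proof. by move=> us /permP/perm_uniq <-. Qed.

(** * Points of the moduli space *)

Section ModuliPoints.
Variables (K : fieldType) (n : nat) (A : comAlgType K).
Implicit Types (x y : Mbar K n A).

Lemma Mbar_inv x i j k (ijk : uniq [:: i; j; k]) (ikj : uniq [:: i; k; j]) :
  Mbar_mu x ikj = P1inv (Mbar_mu x ijk).
Proof. exact/eq_mul1P/(M_mul1 (svalP x)). Qed.

Lemma Mbar_compl x i j k (ijk : uniq [:: i; j; k]) (jik : uniq [:: j; i; k]) :
  Mbar_mu x jik = P1compl (Mbar_mu x ijk).
Proof. exact/eq_addP/(M_add1 (svalP x)). Qed.

Lemma Mbar_mul x i j k l (ijk : uniq [:: i; j; k]) (ikl : uniq [:: i; k; l])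
    (ijl : uniq [:: i; j; l]) :
  eq_mul (Mbar_mu x ijk) (Mbar_mu x ikl) (Mbar_mu x ijl).
Proof. exact/eq_mulC/(M_mul (svalP x)). Qed.

(** The cross-ratio [mu_ijk] and the factorizations
[mu_ijk mu_ikl = mu_ijl], [mu_jik mu_jkl = mu_jil], [mu_kij mu_kjl = mu_kil]
are the input of [eq_quad_of_cross]. *)
Lemma Mbar_quad x i j k l (ijl : uniq [:: i; j; l]) (jkl : uniq [:: j; k; l])
    (ikl : uniq [:: i; k; l]) (ijk : uniq [:: i; j; k]) :
  eq_quad (Mbar_mu x ijl) (Mbar_mu x jkl) (Mbar_mu x ikl) 1.
Proof.
have ikj : uniq [:: i; k; j] by apply: (uniq_count ijk) => P /=; ring.
have jik : uniq [:: j; i; k] by apply: (uniq_count ijk) => P /=; ring.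
have kij : uniq [:: k; i; j] by apply: (uniq_count ijk) => P /=; ring.
have jil : uniq [:: j; i; l] by apply: (uniq_count ijl) => P /=; ring.
have kjl : uniq [:: k; j; l] by apply: (uniq_count jkl) => P /=; ring.
have kil : uniq [:: k; i; l] by apply: (uniq_count ikl) => P /=; ring.
apply: (@eq_quad_of_cross _ _ (Mbar_mu x ijk)).
- exact: Mbar_mul.
- rewrite -(Mbar_compl x ijk jik) -(Mbar_compl x ijl jil); exact: Mbar_mul.
- rewrite -(Mbar_inv x ijk ikj) -(Mbar_compl x ikj kij).
  rewrite -(Mbar_compl x jkl kjl) -(Mbar_compl x ikl kil); exact: Mbar_mul.
Qed.

(** Inversion moves [ord_max] from the last place of a triple to the middle one,
and [p |-> 1 - p] moves it from there to the first. *)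
Lemma Mbar_ext x y :
  (forall i j (h : uniq [:: incl i; incl j; ord_max]),
     Mbar_mu x h = Mbar_mu y h) ->
  (forall i j k (h : uniq [:: incl i; incl j; incl k]),
     Mbar_mu x h = Mbar_mu y h) ->
  x = y.
Proof.
move=> exy2 exy3.
have exy_inv i k (imk : uniq [:: incl i; ord_max; incl k]) :
    Mbar_mu x imk = Mbar_mu y imk.
  have ikm : uniq [:: incl i; incl k; ord_max].
    by apply: (uniq_count imk) => P /=; ring.
  by rewrite !(Mbar_inv _ ikm imk) exy2.
have exy_compl j k (mjk : uniq [:: ord_max; incl j; incl k]) :
    Mbar_mu x mjk = Mbar_mu y mjk.
  have jmk : uniq [:: incl j; ord_max; incl k].
    by apply: (uniq_count mjk) => P /=; ring.
  by rewrite !(Mbar_compl _ jmk mjk) exy_inv.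
have exy i j k (ijk : uniq [:: i; j; k]) : Mbar_mu x ijk = Mbar_mu y ijk.
  move: ijk; case: (unliftP ord_max i) => [{}i|] ->;
    case: (unliftP ord_max j) => [{}j|] ->;
    case: (unliftP ord_max k) => [{}k|] ->; rewrite -?inclE => ijk //;
    by exfalso; move: ijk; rewrite /= !inE eqxx ?orbT ?andbF.
case: x y exy {exy2 exy3 exy_inv exy_compl} => [x Mx] [y My] exy.
apply: eq_exist; apply: funext => -[[[i j] k] ijk]; exact: exy.
Qed.

End ModuliPoints.

(** * Restriction of a point of the moduli space to the fibre *)

Section RestrictionMorphism.
Variables (K : fieldType) (n : nat) (e : K) (e0 : e != 0).

Lemma pair_incl_uniq (p : pairs 'I_n) :
  uniq [:: incl (sval p).1; incl (sval p).2; ord_max].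
Proof. by rewrite incl_uniq2 (svalP p). Qed.

Lemma triple_incl_uniq (t : triples 'I_n) :
  uniq [:: incl (sval t).1.1; incl (sval t).1.2; incl (sval t).2].
Proof. by rewrite incl_uniq3; apply: svalP t. Qed.

Definition restrict_coords (A : comAlgType K) (x : Mbar K n A) :
    Qambient K n A :=
  ((fun p => P1scale e0 (Mbar_mu x (pair_incl_uniq p)),
    fun t => Mbar_mu x (triple_incl_uniq t)),
   e%:A).

Lemma restrict_coords_Qeqs (A : comAlgType K) (x : Mbar K n A) :
  Qeqs (restrict_coords x).
Proof.
split=> [i j k ijk ikj|i j k ijk jik|i j k l ijk ikl ijl|i j k ijk ik ij
        |i j ij ji|i j k ij jk ik].
- exact: (M_mul1 (svalP x)).
- exact: (M_add1 (svalP x)).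
- exact: Mbar_mul.
- apply: eq_mul_scale; exact: Mbar_mul.
- apply: eq_add_scale; exact: (M_add1 (svalP x)).
- apply: eq_quad_scale; apply: Mbar_quad.
  by rewrite incl_uniq3 /= !inE negb_or ij ik jk.
Qed.

Definition restrict : morphism (Mbar K n) (Qfibre n e).
Proof.
exists (fun A x => exist (fun y : Q K n A => Qproj K n A y = e%:A)
  (exist _ (restrict_coords x) (restrict_coords_Qeqs x)) erefl).
move=> A B f x; apply: eq_exist; apply: eq_exist; congr ((_, _), _).
- by apply: funext => p; exact/esym/P1scale_bc.
- by rewrite /= linearZ rmorph1.
Defined.

Lemma restrict_nu (A : comAlgType K) (x : Mbar K n A) (i j : 'I_n)
    (ij : i != j) (ijm : uniq [:: incl i; incl j; ord_max]) :
  Qfibre_nu (restrict A x) ij = P1scale e0 (Mbar_mu x ijm).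
Proof.
by rewrite [LHS]/(P1scale e0 (Mbar_mu x _)); congr (P1scale e0 (Mbar_mu x _));
  apply: bool_irrelevance.
Qed.

Lemma restrict_mu (A : comAlgType K) (x : Mbar K n A) (i j k : 'I_n)
    (ijk : uniq [:: i; j; k]) (ijk' : uniq [:: incl i; incl j; incl k]) :
  Qfibre_mu (restrict A x) ijk = Mbar_mu x ijk'.
Proof.
by rewrite [LHS]/(Mbar_mu x _); congr (Mbar_mu x _); apply: bool_irrelevance.
Qed.

Lemma restrict_inj (A : comAlgType K) : injective (restrict A).
Proof.
move=> x y exy; apply: Mbar_ext => [i j ijm|i j k ijk'].
  have ij : i != j by rewrite -incl_uniq2.
  have := congr1 (fun q => P1scale (invr_neq0 e0) (Qfibre_nu q ij)) exy.
  by rewrite /= !(restrict_nu _ _ ijm) !P1scaleK ?mulVf.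
have ijk : uniq [:: i; j; k] by rewrite -incl_uniq3.
by rewrite -!(restrict_mu _ ijk) exy.
Qed.

End RestrictionMorphism.

(** * Extension of a point of the fibre to the moduli space *)

(** An arbitrary point, the value of the total coordinate functions below at
indices that are not distinct. *)
Definition P1infty (K : fieldType) (A : comAlgType K) : P1 K A.
Proof.
exists (fun x => x.2 = 0) => //=.
- by move=> a x y -> ->; rewrite mulr0 addr0.
- by move=> x y -> ->; rewrite mulr0 mul0r.
- by exists (1, 0), 0; rewrite addr0.
Defined.

(** Makes a family indexed by a subtype total, so that coordinates depend on
indices alone and not on proofs that they are distinct. *)
Definition total_family (K : fieldType) (A : comAlgType K) (I : Type)
    (P : pred I) (f : {i | P i} -> P1 K A) (i : I) : P1 K A :=
  oapp f (P1infty A) (insub i).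

Lemma total_familyE (K : fieldType) (A : comAlgType K) (I : Type)
    (P : pred I) (f : {i | P i} -> P1 K A) (i : I) (Pi : P i) :
  total_family f i = f (exist _ i Pi).
Proof. by rewrite /total_family insubT. Qed.

Section Extension.
Variables (K : fieldType) (n : nat) (e : K) (e0 : e != 0).

Lemma Qfibre_ext (A : comAlgType K) (x y : Qfibre n e A) :
  (forall i j (ij : i != j), Qfibre_nu x ij = Qfibre_nu y ij) ->
  (forall i j k (ijk : uniq [:: i; j; k]),
     Qfibre_mu x ijk = Qfibre_mu y ijk) ->
  x = y.
Proof.
case: x y => [[[[nx mx] ex] Qx] /= eex] [[[[ny my] ey] Qy] /= eey] enu emu.
apply: eq_exist; apply: eq_exist; congr ((_, _), _).
- by apply: funext => -[[i j] ij]; apply: enu.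
- by apply: funext => -[[[i j] k] ijk]; apply: emu.
- exact: etrans eex (esym eey).
Qed.

Variables (A : comAlgType K) (x : Qfibre n e A).
Implicit Types i j k l : 'I_n.

Lemma scaled_eps : e^-1 *: eps (sval (sval x)) = 1.
Proof. by rewrite (svalP x : eps _ = _) scalerA mulVf ?scale1r. Qed.

Definition ext_nu i j : P1 K A :=
  total_family (fun p : pairs 'I_n =>
    P1scale (invr_neq0 e0) ((sval (sval x)).1.1 p)) (i, j).

Definition ext_mu i j k : P1 K A := total_family (sval (sval x)).1.2 (i, j, k).

Lemma ext_nuE i j (ij : i != j) :
  ext_nu i j = P1scale (invr_neq0 e0) (Qfibre_nu x ij).
Proof. exact: total_familyE. Qed.

Lemma ext_muE i j k (ijk : uniq [:: i; j; k]) : ext_mu i j k = Qfibre_mu x ijk.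
Proof. exact: total_familyE. Qed.

Lemma ext_mu_inv i j k : uniq [:: i; j; k] ->
  ext_mu i k j = P1inv (ext_mu i j k).
Proof.
move=> ijk.
have ikj : uniq [:: i; k; j] by apply: (uniq_count ijk) => P /=; ring.
rewrite (ext_muE ijk) (ext_muE ikj); apply/eq_mul1P.
exact: (Q_mul1 (svalP (sval x))).
Qed.

Lemma ext_mu_compl i j k : uniq [:: i; j; k] ->
  ext_mu j i k = P1compl (ext_mu i j k).
Proof.
move=> ijk.
have jik : uniq [:: j; i; k] by apply: (uniq_count ijk) => P /=; ring.
rewrite (ext_muE ijk) (ext_muE jik); apply/eq_addP.
exact: (Q_add1 (svalP (sval x))).
Qed.

Lemma ext_mu_mul i j k l : uniq [:: i; j; k] -> uniq [:: i; k; l] ->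
  uniq [:: i; j; l] -> eq_mul (ext_mu i j k) (ext_mu i k l) (ext_mu i j l).
Proof.
move=> ijk ikl ijl; rewrite (ext_muE ijk) (ext_muE ikl) (ext_muE ijl).
exact: (Q_mul (svalP (sval x))).
Qed.

Lemma ext_munu_mul i j k : uniq [:: i; j; k] ->
  eq_mul (ext_mu i j k) (ext_nu i k) (ext_nu i j).
Proof.
move=> ijk; have := ijk; rewrite /= !inE negb_or => /and3P[/andP[ij ik] jk _].
rewrite (ext_muE ijk) (ext_nuE ij) (ext_nuE ik); apply: eq_mul_scale.
exact: (Q_munu (svalP (sval x))).
Qed.

Lemma ext_nu_compl i j : i != j -> ext_nu j i = P1compl (ext_nu i j).
Proof.
move=> ij; have ji : j != i by rewrite eq_sym.
rewrite (ext_nuE ij) (ext_nuE ji); apply/eq_addP.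
by rewrite -scaled_eps; apply: eq_add_scale; apply: (Q_add (svalP (sval x))).
Qed.

Lemma ext_nu_quad i j k : uniq [:: i; j; k] ->
  eq_quad (ext_nu i j) (ext_nu j k) (ext_nu i k) 1.
Proof.
rewrite /= !inE negb_or => /and3P[/andP[ij ik] jk _].
rewrite (ext_nuE ij) (ext_nuE jk) (ext_nuE ik).
by rewrite -scaled_eps; apply: eq_quad_scale; apply: (Q_quad (svalP (sval x))).
Qed.

Definition ext (i j k : 'I_n.+1) : P1 K A :=
  match unlift ord_max i, unlift ord_max j, unlift ord_max k with
  | Some i, Some j, Some k => ext_mu i j k
  | Some i, Some j, None => ext_nu i j
  | Some i, None, Some k => P1inv (ext_nu i k)
  | None, Some j, Some k => P1compl (P1inv (ext_nu j k))
  | _, _, _ => P1infty A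
  end.

(** For [a = nu_ij / e], [b = nu_jk / e] and [c = nu_ik / e], multiplying
[(1 - 1 / b) (1 - 1 / a) = 1 - 1 / c] by [a b c] gives
[(b - 1) (a - 1) c = (c - 1) a b], and the terms [a b c] cancel, leaving
[c + a b = c b + a c]. *)
Lemma ext_mul_at_max i j k : uniq [:: i; j; k] ->
  eq_mul (P1compl (P1inv (ext_nu j k))) (P1compl (P1inv (ext_nu i j)))
         (P1compl (P1inv (ext_nu i k))).
Proof.
move=> /ext_nu_quad quad u v w ju iv kw.
have /= e1 := quad _ _ _ iv ju kw.
by apply: (eq_from_multiple (k := 1) e1); ring.
Qed.

Lemma ext_inv (i j k : 'I_n.+1) : uniq [:: i; j; k] ->
  ext i k j = P1inv (ext i j k).
Proof.
case: (unliftP ord_max i) => [{}i|] ->;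
  case: (unliftP ord_max j) => [{}j|] ->;
  case: (unliftP ord_max k) => [{}k|] ->;
  rewrite /ext ?liftK ?unlift_none -?inclE;
  try by rewrite /= !inE eqxx ?orbT ?andbF.
- by rewrite incl_uniq; apply: ext_mu_inv.
- by [].
- by rewrite P1invK.
- by rewrite incl_uniq => /ext_nu_compl ->; apply: P1compl_inv_compl.
Qed.

Lemma ext_compl (i j k : 'I_n.+1) : uniq [:: i; j; k] ->
  ext j i k = P1compl (ext i j k).
Proof.
case: (unliftP ord_max i) => [{}i|] ->;
  case: (unliftP ord_max j) => [{}j|] ->;
  case: (unliftP ord_max k) => [{}k|] ->;
  rewrite /ext ?liftK ?unlift_none -?inclE;
  try by rewrite /= !inE eqxx ?orbT ?andbF.
- by rewrite incl_uniq; apply: ext_mu_compl.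
- by rewrite incl_uniq; apply: ext_nu_compl.
- by [].
- by rewrite P1complK.
Qed.

Lemma ext_mul (i j k l : 'I_n.+1) : uniq [:: i; j; k] -> uniq [:: i; k; l] ->
  uniq [:: i; j; l] -> eq_mul (ext i j k) (ext i k l) (ext i j l).
Proof.
case: (unliftP ord_max i) => [{}i|] ->;
  case: (unliftP ord_max j) => [{}j|] ->;
  case: (unliftP ord_max k) => [{}k|] ->;
  case: (unliftP ord_max l) => [{}l|] ->;
  rewrite /ext ?liftK ?unlift_none -?inclE;
  try by rewrite /= !inE eqxx ?orbT ?andbF.
(* In this order, [ord_max] is none of the indices, or it is l, k, j, i. *)
- by rewrite !incl_uniq; apply: ext_mu_mul.
- by rewrite !incl_uniq => ijk _ _; apply: ext_munu_mul.
- by rewrite !incl_uniq => _ _ ijl; apply/eq_mul_divl/ext_munu_mul.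
- by rewrite !incl_uniq => _ ikl _; apply/eq_mul_inv/ext_munu_mul.
- rewrite !incl_uniq => jk kl jl; apply/eq_mulC/ext_mul_at_max.
  by rewrite /= !inE negb_or jk jl kl.
Qed.

Definition ext_coords : Mambient K n A :=
  fun t => ext (sval t).1.1 (sval t).1.2 (sval t).2.

Lemma ext_Meqs : Meqs ext_coords.
Proof.
split=> [i j k ijk ikj|i j k ijk jik|i j k l ijk ilj ilk].
- exact/eq_mul1P/ext_inv.
- exact/eq_addP/ext_compl.
- exact/eq_mulC/ext_mul.
Qed.

Lemma restrict_surj : exists y : Mbar K n A, restrict n e0 A y = x.
Proof.
exists (exist _ ext_coords ext_Meqs).
apply: Qfibre_ext => [i j ij|i j k ijk].
  have ijm : uniq [:: incl i; incl j; ord_max] by rewrite incl_uniq.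
  rewrite (restrict_nu _ _ _ ijm) /Mbar_mu /Mcoord /ext_coords /= /ext.
  by rewrite !inclE !liftK unlift_none (ext_nuE ij) P1scaleK ?mulfV.
have ijk' : uniq [:: incl i; incl j; incl k] by rewrite incl_uniq.
rewrite (restrict_mu _ _ _ ijk') /Mbar_mu /Mcoord /ext_coords /= /ext.
by rewrite !inclE !liftK (ext_muE ijk).
Qed.

End Extension.

(** * Isomorphisms of functors of points *)

(** The pointwise inverse is natural because it is so after composition with
the injective map [f]. *)
Lemma bijective_morphism_inverse (K : fieldType) (X Y : kfunctor K)
    (f : morphism X Y) :
  (forall A, injective (f A)) -> (forall A y, exists x, f A x = y) ->
  exists g : morphism Y X, forall A, cancel (f A) (g A) /\ cancel (g A) (f A).
Proof.
move=> f_inj f_surj; pose g A y := sval (cid (f_surj A y)).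
have fgK A : cancel (g A) (f A) by move=> y; apply: svalP (cid (f_surj A y)).
have g_nat (A B : comAlgType K) (h : {lrmorphism A -> B}) y :
    g B (bc Y h y) = bc X h (g A y).
  by apply: f_inj; rewrite app_natural !fgK.
by exists (Morphism g_nat) => A; split=> // x; apply: f_inj; apply: fgK.
Qed.

Lemma morphism_eq (K : fieldType) (X Y : kfunctor K) (f g : morphism X Y) :
  (forall A x, f A x = g A x) -> f = g.
Proof.
case: f g => [f f_nat] [g g_nat] /= efg.
have {}efg : f = g by apply: functional_extensionality_dep => A; apply: funext.
by subst g; congr Morphism; apply: Prop_irrelevance.
Qed.

(** * The isomorphism *)

Theorem proposition5p2 (R : realType) (n : nat) (e : R[i]) (e0 : e != 0) :
  exists phi : morphism (Qfibre n e) (Mbar _ n),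
    [/\ isomorphism phi,
        given_by e0 phi &
        forall psi : morphism (Qfibre n e) (Mbar _ n),
          given_by e0 psi -> psi = phi].
Proof.
have [phi phiK] := bijective_morphism_inverse
  (@restrict_inj _ n e e0) (@restrict_surj _ n e e0).
have phi_given : given_by e0 phi.
  move=> A x; have [_ resK] := phiK A; split=> [i j ij ijm|i j k ijk ijk'].
    by rewrite -{2}(resK x) (restrict_nu _ _ _ ijm) P1scaleK ?mulVf.
  by rewrite -{2}(resK x) (restrict_mu _ _ _ ijk').
exists phi; split=> //.
  by exists (restrict n e0) => A; have [] := phiK A.
move=> psi psi_given; apply: morphism_eq => A x.
have [psi_nu psi_mu] := psi_given A x.
have [phi_nu phi_mu] := phi_given A x.
apply: Mbar_ext => [i j ijm|i j k ijk'].
  have ij : i != j by rewrite -incl_uniq2.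
  by rewrite (psi_nu _ _ ij) (phi_nu _ _ ij).
have ijk : uniq [:: i; j; k] by rewrite -incl_uniq3.
by rewrite (psi_mu _ _ _ ijk) (phi_mu _ _ _ ijk).
Qed.
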